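(* Let $X$ be a dense in itself metric space. If $Q$ is a dense subset of $X$, then $\mathrm{cof}(\mathrm{nwd}_Q)=\mathrm{cof}(\mathrm{nwd}_X)$.
   Context: A space is dense in itself if it has no isolated points. For a topological space $Z$, $\mathrm{nwd}_Z$ denotes the ideal of all nowhere dense subsets of $Z$; $Q$ carries the subspace topology inherited from $X$. For a family $\mathcal F$ of subsets of a set, $\mathrm{cof}(\mathcal F)$ is the minimal cardinality of a subfamily $\mathcal W\subseteq\mathcal F$ such that for every $Y\in\mathcal F$ there exists $Z\in\mathcal W$ with $Y\subseteq Z$. *)

(* Defs.v *)
From mathcomp Require Import all_boot all_order all_algebra.
From mathcomp Require Import all_classical all_reals all_analysis.

Set Implicit Arguments.
Unset Strict Implicit.
Unset Printing Implicit Defensive.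

Local Open Scope classical_set_scope.
Local Open Scope card_scope.

Definition dense_in_itself (T : topologicalType) : Prop :=
  isolated [set: T] = set0.

Definition nwd (T : topologicalType) : set (set T) :=
  [set A | interior (closure A) = set0].
Arguments nwd T : clear implicits.

Definition cofinal_subfamily (T : Type) (F W : set (set T)) : Prop :=
  W `<=` F /\ forall Y, F Y -> exists2 Z, W Z & Y `<=` Z.

(* Every nonempty family S of sets has a member of least cardinality: a maximal
   set M of choice functions for S on which all evaluations M -> A (A in S) are
   injective must be mapped onto some A in S. *)
Lemma card_le_minimum (U : Type) (S : set (set U)) : S !=set0 ->
  exists2 A, S A & forall B, S B -> A #<= B.
Proof.
move=> [A0 SA0].
pose P (M : set (set U -> U)) := forall A, S A ->
  (forall f, M f -> A (f A)) /\
  (forall f g, M f -> M g -> f A = g A -> f = g).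
have [C CP Ctot|M [PM Mmax]] := @Zorn_bigcup _ P.
  move=> A SA; split=> [f [N CN Nf]|f g [N CN Nf] [N' CN' N'g] fg].
    by have [+ _] := CP _ CN _ SA; apply.
  have [NN'|N'N] := Ctot N N' CN CN'.
    by have [_] := CP _ CN' _ SA; apply => //; exact: NN'.
  by have [_] := CP _ CN _ SA; apply => //; exact: N'N.
have [[A SA Asurj]|nsurj] :=
    pselect (exists2 A, S A & A `<=` (fun f => f A) @` M).
  exists A => // B SB.
  apply: (card_le_trans (subset_card_le Asurj)).
  apply: (card_le_trans (card_image_le _ _)).
  have injB : {in M &, injective (fun f : set U -> U => f B)}.
    by move=> f g /set_mem Mf /set_mem Mg; have [_] := PM _ SB; apply.
  have := inj_card_eq injB; rewrite card_eq_le => /andP[_ /card_le_trans]; apply.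
  apply: subset_card_le => _ [f Mf <-].
  by have [+ _] := PM _ SB; apply.
have new A : exists x, S A -> A x /\ ~ ((fun f => f A) @` M) x.
  have fresh B : S B -> exists x, B x /\ ~ ((fun f => f B) @` M) x.
    move=> SB; apply: contrapT => nB; apply: nsurj; exists B => // x Bx.
    by apply: contrapT => nx; apply: nB; exists x.
  have [SA|nSA] := pselect (S A); first by have [x ?] := fresh _ SA; exists x.
  by have [x _] := fresh _ SA0; exists x.
have [h hP] := choice new.
case: (Mmax (M `|` [set h])).
  split; first by move=> f; left.
  move=> /(_ h (or_intror erefl)) Mh.
  by have [_] := hP _ SA0; apply; exists h.
move=> A SA; have [Ah nAh] := hP _ SA; have [MA Minj] := PM _ SA; split.
  by move=> f [/MA//|->].
move=> f g [Mf|->] [Mg|->] // fg; first exact: Minj.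
  by case: nAh; exists f.
by case: nAh; exists g.
Qed.

Lemma cofinal_subfamily_minimum (T : Type) (F : set (set T)) :
  exists W, cofinal_subfamily F W /\
    forall V, cofinal_subfamily F V -> W #<= V.
Proof.
have [|W WF Wmin] := @card_le_minimum _ (cofinal_subfamily F).
  by exists F; split=> // Y FY; exists Y.
by exists W.
Qed.

(* Cardinals are not first-class objects here, so cof F is represented by a
   cofinal subfamily of minimal cardinality, to be compared by #= and #<=. *)
Definition cof (T : Type) (F : set (set T)) : set (set T) :=
  sval (cid (cofinal_subfamily_minimum F)).

Lemma cofP (T : Type) (F : set (set T)) :
  cofinal_subfamily F (cof F) /\
  forall V, cofinal_subfamily F V -> cof F #<= V.
Proof. exact: svalP (cid (cofinal_subfamily_minimum F)). Qed.

(* Main.v *)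
Require Import Defs.
From mathcomp Require Import all_boot all_order all_algebra.
From mathcomp Require Import all_classical all_reals all_analysis.
From mathcomp Require Import lra.

(** Restricting to [Q] and taking closures in [X] are maps between nowhere dense
    sets of [X] and of [Q]; they carry cofinal families to cofinal families, as
    soon as every nowhere dense [A] in [X] lies in the closure of a nowhere dense
    [B] inside [Q].  Such a [B] is a maximal subset of [Q] in which the distance of
    two distinct points is at least half their distance to [A]: away from [A] it
    is locally finite, and maximality makes it accumulate at each point of [A]. *)

Import Order.TTheory GRing.Theory Num.Theory.

Local Open Scope classical_set_scope.
Local Open Scope card_scope.

(** The image under [f] of a least cofinal family of [F] is cofinal in [G], and an image is no
    larger than its source. The maps [f] and [Y |-> Y'] form a Tukey connection. *)
Lemma cof_le_image (T U : Type) (F : set (set T)) (G : set (set U))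
    (f : set T -> set U) :
  (forall Z, F Z -> G (f Z)) ->
  (forall Y, G Y -> exists2 Y', F Y' & forall Z, Y' `<=` Z -> Y `<=` f Z) ->
  cof G #<= cof F.
Proof.
move=> fG Gf; have [[FW Fcof] _] := cofP F.
apply: card_le_trans (card_image_le f (cof F)).
apply: (cofP G).2; split=> [_ [Z WZ <-]|Y /Gf[Y' FY' Y'Z]].
  exact/fG/FW.
have [Z WZ YZ] := Fcof _ FY'.
by exists (f Z); [exists Z|exact: Y'Z].
Qed.

Lemma nwdP (T : topologicalType) (A : set T) :
  nwd T A <-> forall U : set T, open U -> U !=set0 ->
    exists V : set T, [/\ open V, V !=set0, V `<=` U & V `&` A = set0].
Proof.
split=> [A0 U oU [x Ux]|UV].
  have [y Uy Ay] : exists2 y, U y & ~ closure A y.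
    apply: contrapT => UA; suff : interior (closure A) x by rewrite A0.
    apply: filterS (open_nbhs_nbhs (conj oU Ux)) => y Uy.
    by apply: contrapT => nAy; apply: UA; exists y.
  exists (U `&` ~` closure A); split.
  - by apply: openI => //; exact/closed_openC/closed_closure.
  - by exists y.
  - exact: subIsetl.
  - by rewrite -subset0 => z [[_ nAz] Az]; exact/nAz/subset_closure.
rewrite /nwd /= -subset0 => x Ax.
have [||V [oV [y Vy] VA VA0]] := UV (interior (closure A)).
- exact: open_interior.
- by exists x.
have [z [Az Vz]] := interior_subset (VA _ Vy) V (open_nbhs_nbhs (conj oV Vy)).
by have : (V `&` A) z by []; rewrite VA0.
Qed.

Lemma nwd_closure (T : topologicalType) (A : set T) :
  nwd T A -> nwd T (closure A).
Proof. by rewrite /nwd /= -(closure_id (closure A)).1//; exact: closed_closure. Qed.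

Lemma nwd_image_val (T : topologicalType) (Q : set T) (A : set (set_type Q)) :
  dense Q -> nwd (set_type Q) A -> nwd T (set_val @` A).
Proof.
move=> dQ /nwdP nA; apply/nwdP => U oU U0.
have [x [Ux Qx]] := dQ _ U0 oU.
have [||V [[V' oV' <-] [y V'y] V'U V'A]] := nA (set_val @^-1` U).
- by exists U.
- by exists (SigSub (mem_set Qx)).
(* Only the trace of [V'] on [Q] is known to lie in [U], hence the intersection; a point of [A] has
   its value in [Q], so it cannot lie in [V']. *)
exists (V' `&` U); split.
- exact: openI.
- by exists (set_val y); split=> //; exact: V'U.
- exact: subIsetr.
rewrite -subset0 => w [[V'w _] [z Az zw]]; rewrite -{}zw in V'w.
by have : (set_val @^-1` V' `&` A) z by []; rewrite V'A.
Qed.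

Lemma nwd_preimage_val (T : topologicalType) (Q A : set T) :
  dense Q -> nwd T A -> nwd (set_type Q) (set_val @^-1` A).
Proof.
move=> dQ /nwdP nA; apply/nwdP => _ [U oU <-] [x Ux].
have [|V [oV V0 VU VA]] := nA U oU.
  by exists (set_val x).
have [y [Vy Qy]] := dQ _ V0 oV.
exists (set_val @^-1` V); split.
- by exists V.
- by exists (SigSub (mem_set Qy)).
- by move=> z; exact: VU.
by rewrite -preimage_setI VA preimage_set0.
Qed.

Lemma dense_in_itself_open (T : topologicalType) (U : set T) (b : T) :
  dense_in_itself T -> open U -> U !=set0 -> exists2 y, U y & y <> b.
Proof.
move=> Tisol oU [x Ux]; apply: contrapT => Ub.
have Ub' y : U y -> y = b by move=> Uy; apply: contrapT => yb; apply: Ub; exists y.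
suff : isolated [set: T] x by rewrite Tisol.
split; first exact: mem_set.
exists U; first exact: open_nbhs_nbhs.
rewrite setIT; apply/seteqP; split=> [y Uy|_ -> //].
by rewrite /= (Ub' _ Uy) (Ub' _ Ux).
Qed.

Local Open Scope ring_scope.

Section separated_set.
Context {R : realType} {X : metricType R}.
Implicit Types A B Q : set X.

(** This is the bound [dist(b, A) <= 2 * mdist b c], with a witness in [A] in place of the
    infimum. *)
Definition separated A B := forall b c, B b -> B c -> b <> c ->
  exists2 a, A a & mdist b a <= 2 * mdist b c.

(** A small enough ball off [A] holds at most one point of [B]; as no point of [X] is isolated,
    deleting that point leaves a nonempty open set. *)
Lemma separated_nwd A B :
  dense_in_itself X -> nwd X A -> separated A B -> nwd X B.
Proof.
move=> Xd /nwdP nA sB; apply/nwdP => U oU U0.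
have [V [oV [x Vx] VU VA]] := nA U oU U0.
have [r /= r0] : nbhs_ball x V by rewrite nbhs_ballE; exact: open_nbhs_nbhs.
rewrite ballEmdist => xrV.
(* Distinct [b], [c] in [B] within [r / 5] of [x] are less than [2 * r / 5] apart, so some [a] in
   [A] is within [4 * r / 5] of [b], hence within [r] of [x]: impossible in [V]. *)
have r5 : 0 < r / 5 by lra.
pose N := interior (ball x (r / 5)).
have oN : open N by exact: open_interior.
have Nx : N x by exact: nbhsx_ballx.
have NV : N `<=` V.
  move=> y /interior_subset; rewrite ballEmdist /= => xy; apply: xrV => /=; lra.
have BN b c : B b -> N b -> B c -> N c -> b = c.
  move=> Bb /interior_subset Nb Bc /interior_subset Nc.
  move: Nb Nc; rewrite ballEmdist /= => xb xc; apply: contrapT => bc.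
  have [a Aa ba] := sB _ _ Bb Bc bc.
  suff : (V `&` A) a by rewrite VA.
  split=> //; apply: xrV => /=.
  have := metric_triangle b x c; have := metric_triangle x b a.
  rewrite (metric_sym b x); lra.
have [[b [Bb Nb]]|nB] := pselect (exists b, B b /\ N b); last first.
  exists N; split=> //; first by exists x.
    exact: subset_trans VU.
  by rewrite -subset0 => b [Nb Bb]; apply: nB; exists b.
have [|y Ny yb] := @dense_in_itself_open _ N b Xd oN; first by exists x.
exists (N `&` ~` [set b]); split.
- apply: openI => //; apply: closed_openC.
  exact/accessible_closed_set1/hausdorff_accessible/metric_hausdorff.
- by exists y.
- by move=> z [/NV/VU].
- by rewrite -subset0 => z [[Nz zb] Bz]; apply: zb; exact: BN.
Qed.

Lemma separated_closure A Q : dense Q ->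
  exists B, [/\ B `<=` Q, separated A B & A `<=` closure B].
Proof.
move=> dQ; pose P B := B `<=` Q /\ separated A B.
have [C CP Ctot|B [[BQ sB] Bmax]] := @Zorn_bigcup _ P.
  split=> [x [B /CP[BQ _]]|b c [B CB Bb] [B' CB' B'c]]; first exact: BQ.
  have [BB'|B'B] := Ctot B B' CB CB'.
    by apply: (CP _ CB').2 => //; exact: BB'.
  by apply: (CP _ CB).2 => //; exact: B'B.
exists B; split=> // a Aa N; rewrite -nbhs_ballE => -[e /= e0].
rewrite ballEmdist => aeN.
have [q [/interior_subset + Qq]] : interior (ball a (e / 2)) `&` Q !=set0.
  apply: dQ; last exact: open_interior.
  by exists a; apply: nbhsx_ballx; lra.
rewrite ballEmdist /= => aq.
have [Bq|nBq] := pselect (B q).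
  by exists q; split=> //; apply: aeN => /=; lra.
apply: contrapT => BN0.
have Bfar b : B b -> e <= mdist a b.
  move=> Bb; rewrite leNgt; apply/negP => ab; apply: BN0.
  by exists b; split=> //; exact: aeN.
(* As [mdist a q < e / 2] and [e <= mdist a b], [q] is no farther from [a] than from [b]. Hence
   [mdist b a <= mdist b q + mdist q a <= 2 * mdist b q], so [q] can be added to [B], against
   maximality. *)
have near b : B b -> mdist a q <= mdist b q.
  move=> /Bfar; have := metric_triangle a q b; rewrite (metric_sym q b); lra.
apply: (Bmax (B `|` [set q])).
  split; last by move=> /(_ q (or_intror erefl)).
  by move=> b; left.
split=> [b [/BQ//|->//]|b c [Bb|->] [Bc|->] bc //]; first exact: sB.
  exists a => //; have := near _ Bb; have := metric_triangle b q a.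
  rewrite (metric_sym q a); lra.
exists a => //; have := near _ Bc; have := mdist_ge0 q c.
rewrite (metric_sym c q) (metric_sym q a); lra.
Qed.

End separated_set.

Theorem corollary11 (R : realType) (X : metricType R) (Q : set X) :
  dense_in_itself X -> dense Q -> cof (nwd (set_type Q)) #= cof (nwd X).
Proof.
move=> Xd dQ; rewrite card_eq_le; apply/andP; split.
  apply: (@cof_le_image _ _ _ _ (fun Z => set_val @^-1` Z)) => [Z|Y nY].
    exact: nwd_preimage_val.
  exists (set_val @` Y); first exact: nwd_image_val.
  by move=> Z YZ y Yy; apply: YZ; exists y.
apply: (@cof_le_image _ _ _ _ (fun Z => closure (set_val @` Z))) => [Z nZ|A nA].
  exact/nwd_closure/nwd_image_val.
(* If [Z] contains the trace of [B] on [Q], its closure in [X] contains [closure B], hence [A]. *)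
have [B [BQ sB AB]] := separated_closure A Q dQ.
exists (set_val @^-1` B).
  by apply: nwd_preimage_val => //; exact: separated_nwd sB.
move=> Z BZ; apply: (subset_trans AB); apply: closure_subset => b Bb.
by exists (SigSub (mem_set (BQ _ Bb))) => //; exact: BZ.
Qed.
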